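(* Let $\alpha,\beta\ge 1$ be real numbers. For every $X>1$, the numbers of elliptic curves in the families $\mathcal{E}(X;H_{\alpha,\beta})$ and $\widetilde{\mathcal{E}}(X;H_{\alpha,\beta})$ satisfy $$\#\mathcal{E}(X;H_{\alpha,\beta})=\frac{4}{\alpha^{1/3}\beta^{1/2}\zeta(10)}X^{5/6}+O(X^{1/2})$$ and $$\#\widetilde{\mathcal{E}}(X;H_{\alpha,\beta})=\left(2\left\lfloor\frac{X^{1/3}}{\alpha^{1/3}}\right\rfloor+1\right)\left(2\left\lfloor\frac{X^{1/2}}{\beta^{1/2}}\right\rfloor+1\right)-2\left\lfloor c(\alpha,\beta)X^{1/6}\right\rfloor-1=\frac{4}{\alpha^{1/3}\beta^{1/2}}X^{5/6}+O(X^{1/2}),$$ where $$c(\alpha,\beta):=\min\left\{\frac{1}{3^{1/2}\alpha^{1/6}},\frac{1}{2^{1/3}\beta^{1/6}}\right\}.$$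
   Context: For $(A,B)\in\mathbb{Z}^2$ let $E_{A,B}$ denote the curve $y^2=x^3+Ax+B$; curves are counted by their pairs $(A,B)$. Let $\widetilde{\mathcal{E}}$ be the set of all $E_{A,B}$ with $A,B\in\mathbb{Z}$ and $\Delta_{E_{A,B}}:=-16(4A^3+27B^2)\neq 0$. Let $\mathcal{E}$ be the set of $E_{A,B}\in\widetilde{\mathcal{E}}$ such that there is no prime $p$ with $p^4\mid A$ and $p^6\mid B$. For real $\alpha,\beta\ge1$ the generalized naive height is $H_{\alpha,\beta}(E_{A,B}):=\max\{\alpha|A|^3,\beta B^2\}$. For $X>0$ and a family $\mathcal{F}$, $\mathcal{F}(X;H_{\alpha,\beta}):=\{E_{A,B}\in\mathcal{F} : H_{\alpha,\beta}(E_{A,B})\le X\}$. $\zeta$ is the Riemann zeta function. The parameters $\alpha,\beta$ are fixed; implied constants in $O(\cdot)$ may depend on them. *)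

(* Defs.v *)
From HB Require Import structures.
From mathcomp Require Import all_boot all_order all_algebra finmap.
From mathcomp Require Import all_classical all_reals all_analysis.
Set Implicit Arguments.
Unset Strict Implicit.
Unset Printing Implicit Defensive.
Import Order.TTheory GRing.Theory Num.Theory.
Import numFieldNormedType.Exports.

Local Open Scope classical_set_scope.
Local Open Scope ring_scope.

(* The pair (A, B) stands for the curve y^2 = x^3 + A x + B. *)
Definition curve : Type := (int * int)%type.

Definition disc (E : curve) : int := - 16 * (4 * E.1 ^+ 3 + 27 * E.2 ^+ 2).

Definition curves_all : set curve := [set E | disc E != 0].

Definition curves_min : set curve :=
  [set E | curves_all E /\
    ~ exists p : nat, [/\ prime p, (p%:Z ^+ 4 %| E.1)%Z & (p%:Z ^+ 6 %| E.2)%Z]].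

Definition height (R : realType) (alpha beta : R) (E : curve) : R :=
  Num.max (alpha * `|E.1%:~R| ^+ 3) (beta * E.2%:~R ^+ 2).

Definition upto (R : realType) (F : set curve) (H : curve -> R) (X : R) :
  set curve := F `&` [set E | H E <= X].

(* [fset_set] sends infinite sets to the empty set; [finite_upto] shows that
   this default is never used for alpha, beta >= 1. *)
Definition num_upto (R : realType) (F : set curve) (H : curve -> R) (X : R) :
  nat := #|` fset_set (upto F H X) |.

(* The Dirichlet series, which is the Riemann zeta function for real s > 1
   only. *)
Definition zeta (R : realType) (s : R) : R :=
  limn (series (fun n : nat => (n.+1%:R : R) `^ (- s))).

Definition sing_const (R : realType) (alpha beta : R) : R :=
  Num.min (1 / (3 `^ (1 / 2) * alpha `^ (1 / 6)))
          (1 / (2 `^ (1 / 3) * beta `^ (1 / 6))).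

(* f X = O (g X) uniformly for X > 1, as opposed to for X large enough. *)
Definition bigO_gt1 (R : realType) (f g : R -> R) : Prop :=
  exists C : R, forall X : R, 1 < X -> `|f X| <= C * `|g X|.

Lemma finite_int_ball (R : realType) (X : R) :
  finite_set [set z : int | `|z%:~R| <= X].
Proof.
pose n := (Num.truncn X).+1.
apply: (@sub_finite_set _ _ ([set (k%:Z : int) | k in `I_n] `|`
                             [set (- k%:Z : int) | k in `I_n])); last first.
  by rewrite finite_setU; split; apply: finite_image; exact: finite_II.
move=> z /= zX.
have zn : (`|z| < n)%N.
  rewrite -(@ltr_nat R) natr_absz intr_norm.
  exact: le_lt_trans zX (truncnS_gt X).
have [z0|z0] := leP 0 z.
  by left; exists `|z|%N => //; rewrite gez0_abs.
by right; exists `|z|%N => //; rewrite ltz0_abs // opprK.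
Qed.

Lemma finite_upto (R : realType) (F : set curve) (alpha beta X : R) :
  1 <= alpha -> 1 <= beta -> finite_set (upto F (height alpha beta) X).
Proof.
move=> a1 b1.
have expr_int_ge (z : int) k : `|z%:~R : R| <= `|z%:~R| ^+ k.+1.
  have [->|z0] := eqVneq z 0; first by rewrite normr0 exprn_ge0.
  apply: ler_eXnr => //.
  by rewrite -intr_norm (ler_int R 1) -gtz0_ge1 normr_gt0.
apply: (@sub_finite_set _ _ ([set z : int | `|z%:~R : R| <= X] `*`
                             [set z : int | `|z%:~R : R| <= X])); last first.
  by apply: finite_setX; exact: finite_int_ball.
move=> [A B] [_]; rewrite /= /height ge_max /= => /andP[hA hB]; split => /=.
  apply: le_trans (expr_int_ge A 2) _; apply: le_trans hA.
  by rewrite ler_peMl // exprn_ge0.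
apply: le_trans (expr_int_ge B 1) _; apply: le_trans hB.
by rewrite -normrX ger0_norm ?sqr_ge0 // ler_peMl // sqr_ge0.
Qed.

(* Main.v *)
(* Singular pairs are exactly the (-3 t^2, 2 t^3) with t an integer, so the
   nonsingular curves of height at most X are the lattice points of a box minus
   the points of this cuspidal cubic, and counting both gives the exact formula.

   Every nonsingular (A, B) is uniquely (d^4 A', d^6 B') with (A', B') minimal,
   and the height scales by d^12; hence N_all(X) = sum_d N_min(X / d^12).  No
   Moebius inversion is needed: f(X) = N_min(X) - (K / zeta(10)) X^(5/6)
   satisfies sum_d f(X / d^12) = N_all(X) - K X^(5/6) = O(X^(1/2)), and since
   sum_(d >= 2) d^(-6) <= 1/2 < 1 the bound f = O(X^(1/2)) follows by induction
   on the size of X from f(X) = O(X^(1/2)) - sum_(d >= 2) f(X / d^12). *)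
Require Import Defs.
From mathcomp Require Import all_boot all_order all_algebra finmap.
From mathcomp Require Import all_classical all_reals all_analysis.
From mathcomp Require Import ring lra zify.
Import Order.TTheory GRing.Theory Num.Theory.
Import numFieldNormedType.Exports.
Local Open Scope classical_set_scope.
Local Open Scope ring_scope.

(** * Cardinalities of products and of integer intervals *)

Lemma card_fsetM (K K' : choiceType) (A : {fset K}) (B : {fset K'}) :
  #|` (A `*` B)%fset | = (#|` A| * #|` B|)%N.
Proof.
rewrite -(size_allpairs pair); apply/perm_size/uniq_perm.
- exact: fset_uniq.
- by apply: allpairs_uniq; [exact: fset_uniq..|move=> [? ?] [? ?] _ _ /=].
- move=> [x y]; rewrite in_fsetM /=; apply/andP/allpairsP => [[xA yB]|].
    by exists (x, y).
  by case=> -[x' y'] /= [x'A y'B [-> ->]].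
Qed.

Lemma card_int_ball (n : nat) :
  #|` fset_set [set z : int | `|z| <= n%:Z] | = (2 * n + 1)%N.
Proof.
apply: card_fset_set.
have -> : [set z : int | `|z| <= n%:Z] =
    (fun k : nat => k%:Z - n%:Z) @` `I_(2 * n + 1).
  apply/seteqP; split => [z /= zn|_ [k /= kn <-]]; last by lia.
  exists (absz (z + n%:Z)) => /=; lia.
apply: inj_card_eq => i j _ _ /=; lia.
Qed.

(** * Integer points on the discriminant cubic *)

Lemma singular_param (A B : int) : 4 * A ^+ 3 + 27 * B ^+ 2 = 0 ->
  exists t : int, A = - 3 * t ^+ 2 /\ B = 2 * t ^+ 3.
Proof.
move=> AB.
(* Divisibility by 3 and then by 2 gives A = 3a and B = 2b, which clears the coefficients and leaves
   -a^3 = b^2. *)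
have p3A : (3%R %| A ^+ 3)%Z.
  have e : A ^+ 3 = (- A ^+ 3 - 9 * B ^+ 2) * 3 by lra.
  by apply/dvdzP; eexists; exact: e.
have : (3%R %| A)%Z.
  by move: p3A; rewrite !dvdzE abszX Euclid_dvdX // => /andP[].
case/dvdzP => a Aa; subst A.
have p2B : (2%R %| B ^+ 2)%Z.
  have e : B ^+ 2 = (- 54 * a ^+ 3 - 13 * B ^+ 2) * 2 by lra.
  by apply/dvdzP; eexists; exact: e.
have : (2%R %| B)%Z.
  by move: p2B; rewrite !dvdzE abszX Euclid_dvdX // => /andP[].
case/dvdzP => b Bb; subst B.
have ab : - a ^+ 3 = b ^+ 2 by lra.
have [a0|a0] := eqVneq a 0.
  exists 0; move: ab; rewrite a0 !expr0n /= oppr0 => /esym/eqP.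
  by rewrite sqrf_eq0 => /eqP ->.
(* The quotient t = b / a parametrizes the cusp; it is an integer because a^2 divides b^2. *)
have : (a %| b)%Z.
  have : (a ^+ 2 %| b ^+ 2)%Z.
    by apply/dvdzP; exists (- a); rewrite -ab mulNr -exprS.
  by rewrite dvdz_pexp2r.
case/dvdzP => t bt; subst b.
have at2 : a = - t ^+ 2.
  by apply: (mulfI (expf_neq0 2 a0)); move: ab => ab; lra.
(* Since b = t a = -t^3, the parameter changes sign. *)
by exists (- t); split; rewrite at2; ring.
Qed.

Lemma disc_eq0P (E : curve) :
  reflect (exists t : int, E = (- 3 * t ^+ 2, 2 * t ^+ 3)) (disc E == 0).
Proof.
case: E => A B; rewrite /disc /= mulf_eq0 /=; apply: (iffP eqP).
  by case/singular_param => t [-> ->]; exists t.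
by case=> t [-> ->]; ring.
Qed.

(** * Height bounds and the exact count of nonsingular pairs *)

Section Height.
Context {R : realType}.
Implicit Types a X y alpha beta : R.

Lemma powR_rootK a (n : nat) : 0 <= a -> (0 < n)%N ->
  (a `^ (1 / n%:R)) ^+ n = a.
Proof.
move=> a0 n0.
rewrite -powR_mulrn ?powR_ge0 // -powRrM mul1r mulVf ?powRr1 //.
by rewrite pnatr_eq0 -lt0n.
Qed.

Lemma mul_expr_le a X y (n : nat) : 0 < a -> 0 <= X -> 0 <= y -> (0 < n)%N ->
  (a * y ^+ n <= X) = (y <= X `^ (1 / n%:R) / a `^ (1 / n%:R)).
Proof.
move=> a0 X0 y0 n0; rewrite ler_pdivlMr ?powR_gt0 //.
rewrite -{1}(powR_rootK a n (ltW a0) n0) -{1}(powR_rootK X n X0 n0) -exprMn.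
by rewrite mulrC ler_pXn2r // nnegrE ?mulr_ge0 ?powR_ge0.
Qed.

Lemma normz_le_floor (z : int) y :
  (`|z%:~R| <= y) = (`|z| <= Num.floor y).
Proof. by rewrite floor_ge_int intr_norm. Qed.

Lemma height_le alpha beta X (A B : int) : 0 < alpha -> 0 < beta -> 0 <= X ->
  (height alpha beta (A, B) <= X) =
  (`|A| <= Num.floor (X `^ (1 / 3) / alpha `^ (1 / 3))) &&
  (`|B| <= Num.floor (X `^ (1 / 2) / beta `^ (1 / 2))).
Proof.
move=> a0 b0 X0; rewrite /height ge_max /= -!normz_le_floor.
by rewrite -[B%:~R ^+ 2]real_normK ?num_real // !mul_expr_le.
Qed.

(** On the cuspidal cubic the two terms of the height are 27 alpha t^6 and 4 beta t^6. Sixth roots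
    turn 27 and 4 into 3^(1/2) and 2^(1/3), hence the minimum in [sing_const]. *)
Lemma height_singular_le alpha beta X (t : int) :
  0 < alpha -> 0 < beta -> 0 <= X ->
  (height alpha beta (- 3 * t ^+ 2, 2 * t ^+ 3) <= X) =
  (`|t| <= Num.floor (sing_const alpha beta * X `^ (1 / 6))).
Proof.
move=> a0 b0 X0; rewrite /height ge_max /= -!normz_le_floor.
rewrite minr_pMl ?powR_ge0 // le_min; congr (_ && _).
  have -> : alpha * `|(- 3 * t ^+ 2)%:~R| ^+ 3 =
      (3 ^+ 3 * alpha) * `|t%:~R| ^+ 6.
    rewrite rmorphM /= rmorphXn /= normrM normrX rmorphN /= normrN.
    rewrite ger0_norm //; ring.
  rewrite mul_expr_le ?mulr_gt0 // powRM ?exprn_ge0 ?(ltW a0) //.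
  rewrite -powR_mulrn // -powRrM mulrC !div1r.
  by rewrite (_ : 3 / 6 = 2^-1 :> R); last field.
have -> : beta * (2 * t ^+ 3)%:~R ^+ 2 = (2 ^+ 2 * beta) * `|t%:~R| ^+ 6.
  rewrite rmorphM /= rmorphXn /= -[6%N]/(2 * 3)%N exprM real_normK ?num_real //.
  ring.
rewrite mul_expr_le ?mulr_gt0 // powRM ?exprn_ge0 ?(ltW b0) //.
rewrite -powR_mulrn // -powRrM mulrC !div1r.
by rewrite (_ : 2 / 6 = 3^-1 :> R); last field.
Qed.

Lemma floor_int_ball y : 0 <= y ->
  (#|` fset_set [set z : int | `|z| <= Num.floor y] |)%:Z = 2 * Num.floor y + 1.
Proof.
move=> y0; have f0 : 0 <= Num.floor y by rewrite floor_ge0.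
by rewrite -(gez0_abs f0) card_int_ball; lia.
Qed.

Lemma finite_normz_le (n : int) : finite_set [set z : int | `|z| <= n].
Proof.
apply: sub_finite_set (finite_int_ball (n%:~R : R)) => z /=.
by rewrite -intr_norm ler_int.
Qed.

Lemma num_curves_all alpha beta X : 1 <= alpha -> 1 <= beta -> 0 <= X ->
  (num_upto curves_all (height alpha beta) X)%:Z
  = (2 * Num.floor (X `^ (1 / 3) / alpha `^ (1 / 3)) + 1)
    * (2 * Num.floor (X `^ (1 / 2) / beta `^ (1 / 2)) + 1)
    - 2 * Num.floor (sing_const alpha beta * X `^ (1 / 6)) - 1.
Proof.
move=> a1 b1 X0.
have a0 := lt_le_trans ltr01 a1; have b0 := lt_le_trans ltr01 b1.
have sc0 : 0 <= sing_const alpha beta.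
  by rewrite le_min !divr_ge0 ?mulr_ge0 ?powR_ge0.
rewrite -!floor_int_ball ?divr_ge0 ?mulr_ge0 ?powR_ge0 //.
rewrite -addrA -opprD -floor_int_ball ?mulr_ge0 ?powR_ge0 //.
set bA := [set z : int | _]; set bB := [set z : int | _].
set bC := [set z : int | _].
pose sing (t : int) : curve := (- 3 * t ^+ 2, 2 * t ^+ 3).
have finA : finite_set bA by exact: finite_normz_le.
have finB : finite_set bB by exact: finite_normz_le.
have finC : finite_set bC by exact: finite_normz_le.
have finS := finite_image sing finC.
have finAB := finite_setX finA finB.
have sub : sing @` bC `<=` bA `*` bB.
  move=> _ [t tC <-]; apply/andP; rewrite /= -height_le //.
  by rewrite height_singular_le.
have -> : num_upto curves_all (height alpha beta) X =
    #|` fset_set ((bA `*` bB) `\` (sing @` bC)) |.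
  congr (#|` fset_set _ |); apply/seteqP.
  split=> [[A B] /= [AB0 /= ABX]|[A B] /= [[hA hB] nS]].
    split; first by apply/andP; rewrite -height_le.
    move=> [t _ st]; move: AB0; rewrite /curves_all /= => /disc_eq0P; apply.
    by exists t.
  have ABX : height alpha beta (A, B) <= X by rewrite height_le //; apply/andP.
  split => //=; apply/disc_eq0P => -[t ABt]; apply: nS; exists t => //.
  by rewrite /bC /= -height_singular_le // -ABt.
(* The parametrization is injective: t^2 and t^3 determine t, by cancelling t^2 when t is
   nonzero. *)
have cardS : #|` fset_set (sing @` bC)| = #|` fset_set bC|.
  rewrite (fset_set_image _ finC) (card_in_imfset imfset_key) //=.
  move=> s t _ _ [] /(mulfI (_ : - 3 != 0)) -/(_ isT) s2.
  move=> /(mulfI (_ : 2 != 0)) -/(_ isT) s3.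
  have [t0|t0] := eqVneq t 0.
    by apply/eqP; move/eqP: s2; rewrite t0 expr0n /= sqrf_eq0.
  by apply: (mulfI (expf_neq0 2 t0)); rewrite -{1}s2 -!exprSr.
(* The removed points lie in the box, so the natural-number subtraction from [cardfsD] does not
   truncate. *)
have : (fset_set (sing @` bC) `<=` fset_set (bA `*` bB))%fset.
  by rewrite -fset_set_sub.
move=> /fsubset_leq_card.
rewrite fset_setD // cardfsD -fset_setI // setIidr // fset_setX // card_fsetM.
rewrite cardS; lia.
Qed.
End Height.

(** * Scaling and minimal curves *)

Definition scale_curve (d : nat) (E : curve) : curve :=
  (d%:Z ^+ 4 * E.1, d%:Z ^+ 6 * E.2).

Lemma disc_scale d E : disc (scale_curve d E) = d%:Z ^+ 12 * disc E.
Proof. by rewrite /disc /=; ring. Qed.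

Lemma scale_curve_inj d : (0 < d)%N -> injective (scale_curve d).
Proof.
move=> d0 [A B] [A' B'] [].
have dz k : d%:Z ^+ k != 0 by rewrite expf_neq0 // eqz_nat -lt0n.
by move=> /(mulfI (dz 4)) -> /(mulfI (dz 6)) ->.
Qed.

Lemma scale_curveM d e E :
  scale_curve d (scale_curve e E) = scale_curve (d * e) E.
Proof. by rewrite /scale_curve /= PoszM !exprMn !mulrA. Qed.

Lemma curves_allE E : curves_all E = (disc E != 0).
Proof. by []. Qed.

Lemma scale_curves_all d E : (0 < d)%N ->
  curves_all (scale_curve d E) <-> curves_all E.
Proof.
move=> d0; rewrite !curves_allE disc_scale mulf_eq0 expf_eq0 /=.
by rewrite eqz_nat -[d == 0]negbK -lt0n d0.
Qed.

(** Descent on |A| + |B|: a curve that is not minimal can be divided by some (p^4, p^6), and d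
    collects these primes. *)
Lemma curves_min_decomp E : curves_all E ->
  exists d F, [/\ (0 < d)%N, curves_min F & E = scale_curve d F].
Proof.
have [n] := ubnP (absz E.1 + absz E.2); elim: n E => // n IH E En EN.
have [Emin|] := pselect (curves_min E).
  exists 1%N, E; split=> //; case: {En EN Emin} E => A B.
  by rewrite /scale_curve /= !expr1n !mul1r.
move=> nmin.
have [p [pp p4 p6]] : exists p : nat,
    [/\ prime p, (p%:Z ^+ 4 %| E.1)%Z & (p%:Z ^+ 6 %| E.2)%Z].
  by apply: contrapT => np; apply: nmin.
case/dvdzP: p4 => A EA; case/dvdzP: p6 => B EB.
have EF : E = scale_curve p (A, B).
  case: E EA EB {En EN nmin} => [? ?] /= -> ->.
  by rewrite /scale_curve /= ![p%:Z ^+ _ * _]mulrC.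
have p0 := prime_gt0 pp.
have FN : curves_all (A, B) by move: EN; rewrite EF scale_curves_all.
have [|d [F [d0 Fmin FE]]] := IH (A, B) _ FN.
  have ABn0 : (0 < absz A + absz B)%N.
    rewrite lt0n; apply/negP; rewrite addn_eq0 !absz_eq0.
    move=> /andP[/eqP A0 /eqP B0].
    by move: FN; rewrite A0 B0.
  have E1 : absz E.1 = (p ^ 4 * absz A)%N by rewrite EF abszM abszX.
  have E2 : absz E.2 = (p ^ 6 * absz B)%N by rewrite EF abszM abszX.
  move: En; rewrite E1 E2 ltnS => En.
  apply: leq_trans En; have p1 := prime_gt1 pp.
  have p4 : (1 < p ^ 4)%N by rewrite -{1}(expn0 p) ltn_exp2l.
  have p6 : (1 < p ^ 6)%N by rewrite -{1}(expn0 p) ltn_exp2l.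
  (* When A = 0 the strict decrease comes from B, nonzero by nonsingularity; otherwise it comes from
     A. *)
  have [A0|A0] := posnP (absz A).
    by move: ABn0; rewrite A0 muln0 !add0n => B0; rewrite ltn_Pmull.
  by rewrite -addSn leq_add ?ltn_Pmull ?leq_pmull ?(ltnW p6).
exists (p * d)%N, F; split=> //; first by rewrite muln_gt0 p0.
by rewrite EF FE scale_curveM.
Qed.

(** A prime p dividing d is coprime to e, so d^4 E.1 = e^4 F.1 forces p^4 to divide F.1. Likewise
    p^6 divides F.2, against the minimality of F. *)
Lemma scale_coprime_min d e E F : (0 < d)%N -> coprime d e -> curves_min F ->
  scale_curve d E = scale_curve e F -> d = 1%N.
Proof.
move=> d0 de [_ Fmin] [e4 e6]; apply/eqP; apply: contrapT => /negP d1.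
have pp : prime (pdiv d) by apply: pdiv_prime; lia.
have pe k (x y : int) : d%:Z ^+ k * x = e%:Z ^+ k * y ->
    ((pdiv d)%:Z ^+ k %| y)%Z.
  move=> xy.
  have cop : coprimez ((pdiv d)%:Z ^+ k) (e%:Z ^+ k).
    apply/coprimezXl/coprimezXr; rewrite coprimezE /=.
    exact: coprime_dvdl (pdiv_dvd d) de.
  rewrite -(Gauss_dvdzr _ cop) -xy; apply: dvdz_mulr; apply: dvdz_exp2r.
  by rewrite dvdzE /= pdiv_dvd.
by apply: Fmin; exists (pdiv d); split; [|exact: pe e4|exact: pe e6].
Qed.

(** Cancelling gcd(d, e) leaves coprime factors; [scale_coprime_min], applied in both directions,
    shows that both are 1. *)
Lemma scale_min_inj d e E F : (0 < d)%N -> (0 < e)%N ->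
  curves_min E -> curves_min F ->
  scale_curve d E = scale_curve e F -> d = e.
Proof.
move=> d0 e0 Emin Fmin; pose g := gcdn d e.
have g0 : (0 < g)%N by rewrite gcdn_gt0 d0.
have dE : d = (g * (d %/ g))%N by rewrite mulnC divnK ?dvdn_gcdl.
have eE : e = (g * (e %/ g))%N by rewrite mulnC divnK ?dvdn_gcdr.
rewrite [X in scale_curve X E]dE [X in scale_curve X F]eE -!scale_curveM => eqg.
have eq1 := scale_curve_inj g g0 _ _ eqg.
have cop : coprime (d %/ g) (e %/ g).
  by rewrite /coprime -(eqn_pmul2l g0) muln_gcdr -dE -eE muln1.
rewrite dE (scale_coprime_min _ _ _ _ _ cop Fmin eq1); last first.
  by rewrite divn_gt0 // dvdn_leq ?dvdn_gcdl.
rewrite coprime_sym in cop.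
rewrite eE (scale_coprime_min _ _ _ _ _ cop Emin (esym eq1)) //.
by rewrite divn_gt0 // dvdn_leq ?dvdn_gcdr.
Qed.

(** * Sorting all curves by their scaling factor *)

Section Count.
Context {R : realType} (alpha beta : R).
Hypotheses (alpha_ge1 : 1 <= alpha) (beta_ge1 : 1 <= beta).
Implicit Types X y : R.

Let H := height alpha beta.

Lemma height_scale d E : H (scale_curve d E) = d%:R ^+ 12 * H E.
Proof.
have E1 : (scale_curve d E).1%:~R = d%:R ^+ 4 * E.1%:~R :> R.
  by rewrite intrM rmorphXn.
have E2 : (scale_curve d E).2%:~R = d%:R ^+ 6 * E.2%:~R :> R.
  by rewrite intrM rmorphXn.
rewrite /H /height E1 E2 maxr_pMr ?exprn_ge0 //.
rewrite normrM normrX ger0_norm ?ler0n //.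
by congr Num.max; rewrite exprMn -exprM mulrCA.
Qed.

(** A nonsingular pair has a nonzero coordinate, whose term in the maximum is at least 1. This
    bounds the scaling factors that occur and makes the counts vanish below X = 1. *)
Lemma height_ge1 E : curves_all E -> 1 <= H E.
Proof.
case: E => A B; rewrite curves_allE /H /height le_max /=.
have ge1 (z : int) : z != 0 -> 1 <= `|z%:~R| :> R.
  by move=> z0; rewrite -intr_norm (ler_int R 1) -gtz0_ge1 normr_gt0.
have [-> B0|A0 _] := eqVneq A 0.
  apply/orP; right; have {}B0 : B != 0 by apply: contra B0 => /eqP ->.
  rewrite -[B%:~R ^+ 2]real_normK ?num_real //.
  by rewrite -[leLHS]mulr1 ler_pM // exprn_ege1 // ge1.
by apply/orP; left; rewrite -[leLHS]mulr1 ler_pM // exprn_ege1 // ge1.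
Qed.

Lemma num_upto_lt1 F X : F `<=` curves_all -> X < 1 -> num_upto F H X = 0%N.
Proof.
move=> Fall X1; rewrite /num_upto (_ : upto F H X = set0) ?fset_set0 //.
apply/seteqP; split=> // E [/Fall /height_ge1 H1 /= HX].
by move: (lt_le_trans X1 H1); rewrite ltNge HX.
Qed.

(** A curve with scaling factor d has height at least d^12, so d runs only up to D. With D free, it
    can later be enlarged until the partial sum of zeta(10) is accurate. *)
Lemma num_curves_all_sum X (D : nat) : X < D.+1%:R ^+ 12 ->
  num_upto curves_all H X =
  (\sum_(i < D) num_upto curves_min H (X / i.+1%:R ^+ 12))%N.
Proof.
move=> XD.
pose F (i : nat) := scale_curve i.+1 @` upto curves_min H (X / i.+1%:R ^+ 12).
have finF i : finite_set (F i) by apply: finite_image; exact: finite_upto.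
have cardF i : #|` fset_set (F i)| = num_upto curves_min H (X / i.+1%:R ^+ 12).
  rewrite /F fset_set_image; last exact: finite_upto.
  by rewrite (card_in_imfset imfset_key) // => x y _ _; exact: scale_curve_inj.
under eq_bigr do rewrite -cardF.
(* Uniqueness of the scaling factor makes the images disjoint, so their cardinalities add. *)
rewrite trivIset_sum_card //; last first.
  move=> i j _ _ [_ [[E [Emin _] <-] [E' [E'min _] /esym/scale_min_inj]]].
  by move=> /(_ isT isT Emin E'min) [].
rewrite -bigcup_mkord; congr (#|` fset_set _ |).
have pos i : 0 < i.+1%:R ^+ 12 :> R by rewrite exprn_gt0.
apply/seteqP; split=> [E [Eall /= EX]|E [i /= iD [E' [E'min /= E'X] <-]]].
  have [d [E' [d0 E'min EE']]] := curves_min_decomp _ Eall.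
  case: d d0 EE' => // d _ EE'.
  have E'H := height_ge1 _ E'min.1.
  move: EX; rewrite EE' height_scale => E'X.
  exists d; last first.
    by exists E' => //; split => //=; rewrite ler_pdivlMr // mulrC.
  rewrite /= -ltnS -(ltr_nat R) -(@ltr_pXn2r R 12) ?nnegrE //.
  apply: le_lt_trans XD; apply: le_trans E'X.
  by rewrite ler_peMr // ltW.
split; first by apply/scale_curves_all => //; exact: E'min.1.
by rewrite /= height_scale mulrC -ler_pdivlMr.
Qed.

End Count.

(** * The value zeta(10) and the inversion of the sum over scaling factors *)

Section Zeta.
Context {R : realType}.
Implicit Types X : R.

(** Telescoping: 2x(x + 1) <= (x + 1)^6 for x >= 1 gives 1/(x + 1)^6 <= (1/x - 1/(x + 1))/2. *)
Lemma sum_inv6_le (D : nat) : \sum_(i < D) (i.+2%:R ^+ 6)^-1 <= 2^-1 :> R.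
Proof.
suff : \sum_(i < D) (i.+2%:R ^+ 6)^-1 <= (1 - D.+1%:R^-1) / 2 :> R.
  have : 0 <= D.+1%:R^-1 :> R by rewrite invr_ge0.
  by move: (D.+1%:R^-1) => y ? /le_trans; apply; lra.
elim: D => [|D IH]; first by rewrite big_ord0 invr1 subrr mul0r.
rewrite big_ord_recr /=; apply: le_trans (lerD IH (lexx _)) _.
set x : R := D.+1%:R; have x1 : 1 <= x by rewrite ler1n.
have -> : D.+2%:R = x + 1 by rewrite -natr1.
have x0 : 0 < x by lra.
have y0 : 0 < x + 1 by lra.
have key : 2 * x * (x + 1) <= (x + 1) ^+ 6.
  have h3 : (x + 1) ^+ 3 <= (x + 1) ^+ 6 by rewrite ler_weXn2l //; lra.
  apply: le_trans h3; nra.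
have : ((x + 1) ^+ 6)^-1 <= (2 * x * (x + 1))^-1.
  by rewrite lef_pV2 ?posrE ?exprn_gt0 ?mulr_gt0.
have -> : (2 * x * (x + 1))^-1 = (x^-1 - (x + 1)^-1) / 2.
  by field; rewrite !gt_eqF.
by move: (_^-1) (_^-1) (_^-1) => a b c; lra.
Qed.

Lemma zeta_seriesE (D : nat) :
  series (fun n : nat => (n.+1%:R : R) `^ (- 10)) D =
  \sum_(i < D) (i.+1%:R ^+ 10)^-1.
Proof.
rewrite /series /= big_mkord; apply: eq_bigr => i _.
by rewrite powR_invn.
Qed.

Lemma zeta10_nondecreasing :
  nondecreasing_seq (series (fun n : nat => (n.+1%:R : R) `^ (- 10))).
Proof.
apply/nondecreasing_seqP => D.
by rewrite !zeta_seriesE big_ord_recr /= lerDl invr_ge0 exprn_ge0.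
Qed.

(** [limn] is meaningful only on convergent sequences; convergence makes [zeta 10] the true sum.
    Comparison with sixth powers bounds the partial sums by 1 + 1/2. *)
Lemma zeta10_cvg : cvgn (series (fun n : nat => (n.+1%:R : R) `^ (- 10))).
Proof.
apply: nondecreasing_is_cvgn; first exact: zeta10_nondecreasing.
exists 2 => _ [D _ <-]; rewrite zeta_seriesE.
case: D => [|D]; first by rewrite big_ord0.
rewrite big_ord_recl /= expr1n invr1.
have : \sum_(i < D) ((bump 0 i).+1%:R ^+ 10)^-1 <=
    \sum_(i < D) (i.+2%:R ^+ 6)^-1 :> R.
  apply: ler_sum => i _; rewrite lef_pV2 ?posrE ?exprn_gt0 //.
  by rewrite ler_weXn2l // ler1n.
have := sum_inv6_le D; lra.
Qed.

Lemma zeta10_partial_le (D : nat) :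
  \sum_(i < D) (i.+1%:R ^+ 10)^-1 <= zeta 10 :> R.
Proof.
rewrite -zeta_seriesE; apply: nondecreasing_cvgn_le.
  exact: zeta10_nondecreasing.
exact: zeta10_cvg.
Qed.

Lemma zeta10_ge1 : 1 <= zeta 10 :> R.
Proof. by have := zeta10_partial_le 1; rewrite big_ord1 expr1n invr1. Qed.

Lemma zeta10_tail (e : R) : 0 < e ->
  \forall D \near \oo, zeta 10 - \sum_(i < D) (i.+1%:R ^+ 10)^-1 <= e.
Proof.
move=> e0; have /cvgrPdist_le /(_ e e0) := zeta10_cvg.
apply: filterS => D; rewrite -/(zeta 10) zeta_seriesE.
exact: le_trans (ler_norm _).
Qed.

(** Used for y = d and m = 12: r = 5/6 produces d^10, the source of zeta(10), and r = 1/2 produces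
    the d^6 of the error terms. *)
Lemma powR_div_exp X y (m k : nat) (r : R) : 0 <= X -> 0 < y ->
  m%:R * r = k%:R -> (X / y ^+ m) `^ r = X `^ r / y ^+ k.
Proof.
move=> X0 y0 mk; rewrite powRM ?invr_ge0 ?exprn_ge0 ?(ltW y0) //; congr (_ * _).
rewrite -powR_invn ?(ltW y0) // -powRrM mulNr mk powR_invn ?(ltW y0) //.
Qed.

(** The constant M = K + 2C + 2 satisfies C + 1 + M/2 <= M: C comes from [Nall], 1 from the tail of
    zeta, M/2 from the terms d >= 2. It also exceeds K, which settles X < 1. *)
Lemma inversion_asymptotic (Nall Nmin : R -> R) (K C : R) :
  0 <= K -> 0 <= C ->
  (forall X, 1 <= X -> `|Nall X - K * X `^ (5 / 6)| <= C * X `^ (1 / 2)) ->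
  (forall X, 0 < X -> X < 1 -> Nmin X = 0) ->
  (forall X (D : nat), 0 < X -> X < D.+1%:R ^+ 12 ->
    Nall X = \sum_(i < D) Nmin (X / i.+1%:R ^+ 12)) ->
  forall X, 0 < X ->
    `|Nmin X - K / zeta 10 * X `^ (5 / 6)| <= (K + 2 * C + 2) * X `^ (1 / 2).
Proof.
move=> K0 C0 Nall_asym Nmin0 Nall_sum.
pose f X := Nmin X - K / zeta 10 * X `^ (5 / 6).
have z1 := zeta10_ge1; have z0 : 0 < zeta 10 :> R by lra.
have Kz : 0 <= K / zeta 10 by rewrite divr_ge0 // ltW.
suff bound (n : nat) X : 0 < X -> X < 2 ^+ n ->
    `|f X| <= (K + 2 * C + 2) * X `^ (1 / 2).
  move=> X X0; apply: (bound (Num.truncn X).+1) => //.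
  apply: lt_trans (truncnS_gt X) _.
  by rewrite -natrX ltr_nat ltn_expl.
elim: n X => [|n IH] X X0 Xn.
  (* For X < 1 only the main term of f survives, and X^(5/6) <= X^(1/2). *)
  rewrite expr0 in Xn.
  rewrite /f Nmin0 // sub0r normrN ger0_norm; last first.
    by apply: mulr_ge0; rewrite ?powR_ge0.
  apply: ler_pM; rewrite ?powR_ge0 //.
    by apply: (@le_trans _ _ K); [rewrite ler_pdivrMr // ler_peMr|lra].
  have -> : 5 / 6 = 1 / 2 + 1 / 3 :> R by field.
  rewrite powRD ?(gt_eqF X0) ?implybT // ler_piMr ?powR_ge0 //.
  apply: (@le_trans _ _ (1 `^ (1 / 3))); last by rewrite powR1.
  by rewrite ge0_ler_powR ?nnegrE ?(ltW X0) ?(ltW Xn).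
have [X1|X1] := ltP X 1.
  by apply: IH => //; apply: lt_le_trans X1 _; rewrite exprn_ege1 // ler1n.
set s := X `^ (1 / 2).
have s1 : 1 <= s by rewrite -[leLHS](powRr0 X) ler_powR //; lra.
set q := X `^ (5 / 6).
have q0 : 0 < q by rewrite powR_gt0.
(* This tolerance makes the zeta tail, once multiplied by (K / zeta 10) q, at most 1; the added 1
   keeps the denominator positive even if K = 0. *)
have e0 : 0 < (1 / (K / zeta 10 * q + 1)) :> R.
  by rewrite divr_gt0 // ltr_wpDl // mulr_ge0 // ltW.
have [D /(_ _ (leqnn _)) [XD tailD]] : exists D : nat, forall D', (D <= D')%N ->
   X < D'.+1%:R ^+ 12 /\
   zeta 10 - \sum_(i < D') (i.+1%:R ^+ 10)^-1 <= 1 / (K / zeta 10 * q + 1).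
  have [D0 _ HD] := zeta10_tail _ e0.
  exists (maxn D0 (Num.truncn X)) => D'; rewrite geq_max => /andP[D0D' XD'].
  split; last exact: HD.
  apply: lt_le_trans (truncnS_gt X) _; rewrite -natrX ler_nat.
  apply: leq_trans (XD' : (_.+1 <= D'.+1)%N) _.
  by rewrite -{1}(expn1 D'.+1) leq_pexp2l.
(* D = 0 would mean X < 1; hence the term d = 1, which is f X itself, can be split off. *)
case: D XD tailD => [|D] XD tailD; first by move: XD; rewrite expr1n ltNge X1.
have sumE : Nall X = f X + \sum_(i < D) f (X / i.+2%:R ^+ 12)
    + K / zeta 10 * q * \sum_(i < D.+1) (i.+1%:R ^+ 10)^-1.
  rewrite (Nall_sum X _ X0 XD) mulr_sumr.
  have fE (i : nat) : Nmin (X / i.+1%:R ^+ 12) =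
      f (X / i.+1%:R ^+ 12) + K / zeta 10 * q * (i.+1%:R ^+ 10)^-1.
    rewrite /f (powR_div_exp X i.+1%:R 12 10 (5 / 6)) ?(ltW X0) //; last first.
      by field.
    by rewrite mulrA subrK.
  rewrite (eq_bigr _ (fun (i : 'I_D.+1) _ => fE i)) big_split /=; congr (_ + _).
  by rewrite big_ord_recl /= expr1n divr1.
have sumf : `|\sum_(i < D) f (X / i.+2%:R ^+ 12)| <= (K + 2 * C + 2) * s * 2^-1.
  apply: le_trans (ler_norm_sum _ _ _) _.
  apply: le_trans (ler_wpM2l _ (sum_inv6_le D)); last first.
    by rewrite mulr_ge0 //; lra.
  rewrite mulr_sumr; apply: ler_sum => i _.
  have p0 : 0 < i.+2%:R ^+ 12 :> R by rewrite exprn_gt0.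
  apply: le_trans (IH _ _ _) _; first by rewrite divr_gt0.
    (* With d = i + 2, the bound 2 <= d <= d^12 brings X / d^12 below 2^n. *)
    rewrite ltr_pdivrMr //; apply: lt_le_trans Xn _; rewrite exprSr.
    rewrite ler_wpM2l ?exprn_ge0 //.
    apply: (@le_trans _ _ i.+2%:R); first by rewrite ler_nat.
    by rewrite -[leLHS]expr1 ler_weXn2l // ler1n.
  rewrite (powR_div_exp X i.+2%:R 12 6 (1 / 2)) ?(ltW X0) //; last by field.
  by rewrite mulrA.
set Z := \sum_(i < D.+1) _ in sumE tailD.
have mq0 : 0 <= K / zeta 10 * q by rewrite mulr_ge0 // ltW.
have tail1 : K / zeta 10 * q * (zeta 10 - Z) <= 1.
  apply: le_trans (ler_wpM2l mq0 tailD) _.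
  by rewrite mulrA mulr1 ler_pdivrMr ?mul1r; lra.
have tail0 : 0 <= K / zeta 10 * q * (zeta 10 - Z).
  by rewrite mulr_ge0 // subr_ge0 zeta10_partial_le.
have fXE : f X = (Nall X - K * q) + K / zeta 10 * q * (zeta 10 - Z)
    - \sum_(i < D) f (X / i.+2%:R ^+ 12).
  by rewrite sumE; field; rewrite gt_eqF.
move: sumf (Nall_asym X X1); rewrite fXE -/s -/q !ler_norml.
move: tail1 tail0.
move: (\sum_(i < D) _) (K / zeta 10 * q * _) (Nall X - _) => F G A.
move=> tail1 tail0 /andP[f1 f2] /andP[a1 a2].
have Cs : 0 <= C * s by rewrite mulr_ge0 //; lra.
have Ks : 0 <= K * s by rewrite mulr_ge0 //; lra.
by apply/andP; split; lra.
Qed.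

End Zeta.

(** * Lattice points in the box and the asymptotic count of all curves *)

Lemma box_count_error {R : realType} (a b w : int) (u v s : R) :
  a%:~R <= u < a%:~R + 1 -> b%:~R <= v < b%:~R + 1 ->
  0 <= u <= s -> 0 <= v <= s -> 0 <= w%:~R :> R -> 1 <= s ->
  `|((2 * a + 1) * (2 * b + 1) - 2 * w - 1)%:~R - 4 * (u * v)|
    <= 6 * s + 2 * w%:~R.
Proof.
move=> /andP[a1 a2] /andP[b1 b2] /andP[u0 us] /andP[v0 vs] w0 s1.
(* Put 2a + 1 = 2u + rho and 2b + 1 = 2v + sigma with |rho|, |sigma| <= 1 and expand. The error is
   at most 2 + 2u + 2v + 2w, and s >= 1 absorbs the 2. *)
have -> : ((2 * a + 1) * (2 * b + 1) - 2 * w - 1)%:~R - 4 * (u * v) =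
   (2 * a%:~R + 1 - 2 * u) * (2 * b%:~R + 1 - 2 * v)
   + 2 * u * (2 * b%:~R + 1 - 2 * v)
   + 2 * v * (2 * a%:~R + 1 - 2 * u) - (2 * w%:~R + 1) by ring.
have ha : `|2 * a%:~R + 1 - 2 * u| <= 1 by rewrite ler_norml; lra.
have hb : `|2 * b%:~R + 1 - 2 * v| <= 1 by rewrite ler_norml; lra.
have w0' : `|2 * w%:~R + 1| = 2 * w%:~R + 1 :> R by rewrite ger0_norm; lra.
apply: le_trans (ler_normB _ _) _; rewrite w0'.
apply: (@le_trans _ _ (1 + 2 * u + 2 * v + (2 * w%:~R + 1))); last lra.
rewrite lerD2r; apply: le_trans (ler_normD _ _) _; apply: lerD.
  apply: le_trans (ler_normD _ _) _; apply: lerD.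
    by rewrite normrM mulr_ile1.
  by rewrite normrM ger0_norm ?mulr_ge0 // ler_piMr // mulr_ge0.
by rewrite normrM ger0_norm ?mulr_ge0 // ler_piMr // mulr_ge0.
Qed.

Lemma num_curves_all_asymptotic (R : realType) (alpha beta : R) :
  1 <= alpha -> 1 <= beta ->
  exists2 C : R, 0 <= C & forall X, 1 <= X ->
    `|(num_upto curves_all (height alpha beta) X)%:R
      - 4 / (alpha `^ (1 / 3) * beta `^ (1 / 2)) * X `^ (5 / 6)|
    <= C * X `^ (1 / 2).
Proof.
move=> a1 b1; set c := sing_const alpha beta.
have c0 : 0 <= c by rewrite le_min !divr_ge0 ?mulr_ge0 ?powR_ge0.
(* The 6 is the box error, the 2c the singular points. *)
exists (6 + 2 * c) => [|X X1]; first lra.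
have X0 : 0 <= X by lra.
rewrite pmulrn num_curves_all // -/c.
set u := X `^ (1 / 3) / _; set v := X `^ (1 / 2) / _.
(* The main term is the area of the real box, with half-sides u and v. *)
have -> : 4 / (alpha `^ (1 / 3) * beta `^ (1 / 2)) * X `^ (5 / 6) = 4 * (u * v).
  have -> : 5 / 6 = 1 / 3 + 1 / 2 :> R by field.
  by rewrite powRD ?(@gt_eqF _ _ 0 X) ?implybT ?invfM /u /v; [ring | lra].
have pow1 (a r : R) : 1 <= a -> 0 <= r -> 1 <= a `^ r.
  by move=> a1' r0; rewrite -[leLHS](powRr0 a) ler_powR.
set s := X `^ (1 / 2) in v *.
have s1 : 1 <= s by apply: pow1 => //; lra.
have flo (y : R) : (Num.floor y)%:~R <= y < (Num.floor y)%:~R + 1.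
  by have := floor_itv y; rewrite intrD.
have us : 0 <= u <= s.
  rewrite divr_ge0 ?powR_ge0 //= ler_pdivrMr; last by apply: powR_gt0; lra.
  apply: (@le_trans _ _ s); first by apply: ler_powR => //; lra.
  by rewrite ler_peMr ?powR_ge0 // pow1 //; lra.
have vs : 0 <= v <= s.
  rewrite divr_ge0 ?powR_ge0 //= ler_pdivrMr; last by apply: powR_gt0; lra.
  by rewrite ler_peMr ?powR_ge0 // pow1 //; lra.
have w0 : 0 <= (Num.floor (c * X `^ (1 / 6)))%:~R :> R.
  by rewrite ler0z floor_ge0 mulr_ge0 ?powR_ge0.
have ws : (Num.floor (c * X `^ (1 / 6)))%:~R <= c * s.
  apply: le_trans (floor_le _) _; rewrite ler_wpM2l //.
  by apply: ler_powR => //; lra.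
apply: le_trans (box_count_error _ _ _ _ _ _ (flo u) (flo v) us vs w0 s1) _.
lra.
Qed.

Theorem theorem2p1 (R : realType) (alpha beta : R)
    (halpha : 1 <= alpha) (hbeta : 1 <= beta) :
  [/\ bigO_gt1
        (fun X : R => (num_upto curves_min (height alpha beta) X)%:R
           - 4 / (alpha `^ (1 / 3) * beta `^ (1 / 2) * zeta 10) * X `^ (5 / 6))
        (fun X : R => X `^ (1 / 2)),
      (forall X : R, 1 < X ->
        (num_upto curves_all (height alpha beta) X)%:Z
        = (2 * Num.floor (X `^ (1 / 3) / alpha `^ (1 / 3)) + 1)
          * (2 * Num.floor (X `^ (1 / 2) / beta `^ (1 / 2)) + 1)
          - 2 * Num.floor (sing_const alpha beta * X `^ (1 / 6)) - 1)
    & bigO_gt1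
        (fun X : R => (num_upto curves_all (height alpha beta) X)%:R
           - 4 / (alpha `^ (1 / 3) * beta `^ (1 / 2)) * X `^ (5 / 6))
        (fun X : R => X `^ (1 / 2))].
Proof.
have [C C0 all_asym] := num_curves_all_asymptotic R alpha beta halpha hbeta.
split.
- have K0 : 0 <= 4 / (alpha `^ (1 / 3) * beta `^ (1 / 2)).
    by rewrite divr_ge0 // mulr_ge0 ?powR_ge0.
  pose Nall X : R := (num_upto curves_all (height alpha beta) X)%:R.
  pose Nmin X : R := (num_upto curves_min (height alpha beta) X)%:R.
  have Nmin0 X : 0 < X -> X < 1 -> Nmin X = 0.
    by move=> _ X1; rewrite /Nmin num_upto_lt1 // => E [].
  have Nsum X (D : nat) : 0 < X -> X < D.+1%:R ^+ 12 ->
      Nall X = \sum_(i < D) Nmin (X / i.+1%:R ^+ 12).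
    by move=> _ XD; rewrite /Nall (num_curves_all_sum _ _ _ _ _ D) // natr_sum.
  (* The constant is fixed by unification with [inversion_asymptotic], where K is the leading
     coefficient of the full count. *)
  eexists => X X1; rewrite (ger0_norm (powR_ge0 X (1 / 2))) invfM mulrA.
  apply: (inversion_asymptotic Nall Nmin _ _ K0 C0 all_asym Nmin0 Nsum X).
  exact: lt_trans X1.
- by move=> X X1; apply: num_curves_all => //; lra.
- exists C => X X1; rewrite (ger0_norm (powR_ge0 X (1 / 2))).
  exact/all_asym/ltW.
Qed.
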